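(* Let $(n_k)_{k\ge0}$ be a strictly increasing sequence of positive integers with $n_0=1$ such that for every $\varepsilon>0$ there exists $\lambda\in\mathbb{T}\setminus\{1\}$ with $\sup_{k\ge0}|\lambda^{n_k}-1|\le\varepsilon$. Then for every $\delta>0$ there exists a bounded linear operator $T$ on the Hilbert space $\ell_2(\mathbb{N})$ which has perfectly spanning unimodular eigenvectors and satisfies $\sup_{k\ge0}\|T^{n_k}\|\le 1+\delta$. In particular, $\sigma_p(T)\cap\mathbb{T}$ is uncountable.
   Context: $\mathbb{T}$ is the unit circle in $\mathbb{C}$; $\sigma_p(T)$ is the set of eigenvalues of $T$. A bounded operator $T$ on a complex separable Hilbert space $H$ has perfectly spanning unimodular eigenvectors if there exists a continuous (atomless) Borel probability measure $\sigma$ on $\mathbb{T}$ such that for every Borel set $B\subseteq\mathbb{T}$ with $\sigma(B)=1$, the closed linear span of $\bigcup_{\lambda\in B}\ker(T-\lambda I)$ equals $H$. *)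

(* Defs.v *)
From HB Require Import structures.
From mathcomp Require Import all_boot all_order all_algebra.
From mathcomp Require Import all_classical all_reals all_analysis.
From mathcomp Require Import complex.
Set Implicit Arguments. Unset Strict Implicit. Unset Printing Implicit Defensive.
Import Order.TTheory GRing.Theory Num.Theory.
Local Open Scope classical_set_scope.
Local Open Scope ring_scope.

Section L2.
Variable R : realType.

Definition cseq := nat -> R[i].

Definition cabs (z : R[i]) : R := let: Complex a b := z in Num.sqrt (a ^+ 2 + b ^+ 2).

Definition vadd (x y : cseq) : cseq := fun i => x i + y i.
Definition vopp (x : cseq) : cseq := fun i => - x i.
Definition vscale (a : R[i]) (x : cseq) : cseq := fun i => a * x i.
Definition vzero : cseq := fun _ => 0.

Definition psum2 (x : cseq) (N : nat) : R := \sum_(i < N) cabs (x i) ^+ 2.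

Definition in_l2 (x : cseq) : Prop := exists M : R, forall N, psum2 x N <= M.

Definition l2sq (x : cseq) : R := sup (range (psum2 x)).
Definition l2norm (x : cseq) : R := Num.sqrt (l2sq x).

(* T : cseq -> cseq is a bounded linear operator on l_2(N)
   (only its restriction to l_2 matters). *)
Definition bounded_operator (T : cseq -> cseq) : Prop :=
  [/\ (forall x, in_l2 x -> in_l2 (T x)),
      (forall (a : R[i]) x y, in_l2 x -> in_l2 y ->
          T (vadd (vscale a x) y) = vadd (vscale a (T x)) (T y))
    & exists c : R, forall x, in_l2 x -> l2norm (T x) <= c * l2norm x].

Definition opnorm_le (T : cseq -> cseq) (c : R) : Prop :=
  forall x, in_l2 x -> l2norm (T x) <= c * l2norm x.

Definition eigenspace (T : cseq -> cseq) (l : R[i]) : set cseq :=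
  [set x | in_l2 x /\ T x = vscale l x].

Definition lincomb (n : nat) (c : 'I_n -> R[i]) (xs : 'I_n -> cseq) : cseq :=
  fun i => \sum_(j < n) c j * xs j i.

Definition dense_span (S : set cseq) : Prop :=
  forall y, in_l2 y -> forall eps : R, 0 < eps ->
    exists n (c : 'I_n -> R[i]) (xs : 'I_n -> cseq),
      (forall j, S (xs j)) /\ l2norm (vadd y (vopp (lincomb c xs))) < eps.

Definition unit_circle : set (R * R) := [set p | p.1 ^+ 2 + p.2 ^+ 2 = 1].

Definition to_complex (p : R * R) : R[i] := Complex p.1 p.2.

(* Perfectly spanning unimodular eigenvectors: there is an atomless Borel
   probability measure sigma on T (realised as a probability measure on the
   Borel sets of R x R with sigma(T) = 1) such that for every Borel B
   contained in T with sigma(B) = 1, the eigenvectors with eigenvalues in B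
   span a dense subspace of l_2. *)
Definition perfectly_spanning (T : cseq -> cseq) : Prop :=
  exists sigma : probability (R * R)%type R,
    [/\ sigma unit_circle = 1%E,
        (forall p : R * R, sigma [set p] = 0%E)
      & forall B : set (R * R), measurable B -> B `<=` unit_circle ->
          sigma B = 1%E ->
          dense_span (\bigcup_(p in B) eigenspace T (to_complex p))].

Definition unimodular_point_spectrum (T : cseq -> cseq) : set R[i] :=
  [set l | cabs l = 1 /\ exists x, eigenspace T l x /\ x <> vzero].

End L2.

(* Main.v *)
(** The operator is an infinite product of commuting bounded operators
    [1 + (mu_i - 1) P_i], where the [P_i] are projections of l_2 with a common
    family of eigenvectors [E(e)], [e] in the Cantor set {0,1}^N, such that
    [P_i E(e) = e_i E(e)].  The [P_i] are fixed first; the hypothesis then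
    provides unimodular [mu_i <> 1] with [|mu_i^(n_k) - 1| * ||P_i||] summably
    small uniformly in [k].  Hence [T E(e) = lambda(e) E(e)] with
    [lambda(e) = prod_i mu_i^(e_i)], and since [T^(n_k)] agrees on the span of
    the [E(e)] with the product built from the [mu_i^(n_k)], its norm is at
    most [prod_i (1 + |mu_i^(n_k) - 1| * ||P_i||) <= 1 + delta].

    The map [e |-> E(e)] is continuous and its range spans l_2, so the [E(e)]
    with [e] in any dense subset of the Cantor set already span.  If
    [|mu_i - 1|] decreases fast enough, [lambda] is injective, and the image
    under [lambda] of the coin-tossing measure, realised as Lebesgue measure
    on the binary digits of a point of [0, 1], is the required measure. *)

Require Import Defs.
From HB Require Import structures.
From mathcomp Require Import all_boot all_order all_algebra.
From mathcomp Require Import all_classical all_reals all_analysis.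
From mathcomp Require Import measurable_realfun.
From mathcomp Require Import complex.
From mathcomp Require Import lra ring.
Import Order.TTheory GRing.Theory Num.Theory.
Import numFieldNormedType.Exports.
Local Open Scope classical_set_scope.
Local Open Scope ring_scope.

Set Implicit Arguments.
Unset Strict Implicit.
Unset Printing Implicit Defensive.

(** * The norm of l_2 and its elementary inequalities *)

Section SequenceSpace.
Variable R : realType.
Implicit Types (x y : cseq R) (a z w : R[i]).

Lemma cabs_ge0 z : 0 <= cabs z.
Proof. by case: z => a b; apply: sqrtr_ge0. Qed.

Lemma cabsM z w : cabs (z * w) = cabs z * cabs w.
Proof. exact: Normc.normcM. Qed.

Lemma cabsN z : cabs (- z) = cabs z.
Proof. exact: normcN. Qed.

Lemma cabsD z w : cabs (z + w) <= cabs z + cabs w.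
Proof. exact: le_normcD. Qed.

Lemma cabsBC z w : cabs (z - w) = cabs (w - z).
Proof. by rewrite -cabsN opprB. Qed.

Lemma cabs0 : cabs (0 : R[i]) = 0.
Proof. exact: Normc.normc0. Qed.

Lemma cabs1 : cabs (1 : R[i]) = 1.
Proof. exact: Normc.normc1. Qed.

Lemma cabs_eq0 z : cabs z = 0 -> z = 0.
Proof. exact: Normc.eq0_normc. Qed.

Lemma sqr_cabs z : cabs z ^+ 2 = complex.Re z ^+ 2 + complex.Im z ^+ 2.
Proof. by case: z => a b /=; rewrite sqr_sqrtr // addr_ge0 ?sqr_ge0. Qed.

Lemma ler_Re_cabs z : `|complex.Re z| <= cabs z.
Proof.
rewrite -(@ler_pXn2r _ 2) ?nnegrE ?cabs_ge0 ?normr_ge0 //.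
by rewrite sqr_cabs real_normK ?num_real // lerDl sqr_ge0.
Qed.

Lemma ler_Im_cabs z : `|complex.Im z| <= cabs z.
Proof.
rewrite -(@ler_pXn2r _ 2) ?nnegrE ?cabs_ge0 ?normr_ge0 //.
by rewrite sqr_cabs real_normK ?num_real // lerDr sqr_ge0.
Qed.

Lemma cabs_real (r : R) : cabs (real_complex R r) = `|r|.
Proof. by rewrite /cabs /= expr0n /= addr0 sqrtr_sqr. Qed.

Lemma psum2_ge0 x N : 0 <= psum2 x N.
Proof. by apply: sumr_ge0 => i _; rewrite sqr_ge0. Qed.

Lemma psum2S x N : psum2 x N.+1 = psum2 x N + cabs (x N) ^+ 2.
Proof. by rewrite /psum2 big_ord_recr. Qed.

Lemma in_l2_has_sup x : in_l2 x -> has_sup (range (psum2 x)).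
Proof.
move=> [M hM]; split; first by exists (psum2 x 0), 0%N.
by exists M => _ [N _ <-].
Qed.

Lemma psum2_le_l2sq x N : in_l2 x -> psum2 x N <= l2sq x.
Proof. by move=> /in_l2_has_sup h; apply: sup_upper_bound => //; exists N. Qed.

Lemma l2sq_ge0 x : 0 <= l2sq x.
Proof.
(* Outside l_2 the partial sums have no supremum and [sup] takes its default value 0. *)
have [h|h] := pselect (has_sup (range (psum2 x))); last by rewrite /l2sq sup_out.
apply: le_trans (psum2_ge0 x 0) _.
by apply: sup_upper_bound => //; exists 0%N.
Qed.

Lemma l2norm_ge0 x : 0 <= l2norm x.
Proof. exact: sqrtr_ge0. Qed.

Lemma psum2_le x N : in_l2 x -> psum2 x N <= l2norm x ^+ 2.
Proof. by move=> xl2; rewrite sqr_sqrtr ?l2sq_ge0 ?psum2_le_l2sq. Qed.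

(** Membership and norm bound are returned together because nearly every later estimate needs both;
    squaring [M] keeps square roots out of the estimates. *)
Lemma l2norm_le x M : 0 <= M -> (forall N, psum2 x N <= M ^+ 2) ->
  in_l2 x /\ l2norm x <= M.
Proof.
move=> M0 hM; split; first by exists (M ^+ 2).
rewrite -(ger0_norm M0) -sqrtr_sqr ler_wsqrtr //.
apply: ge_sup; first by exists (psum2 x 0), 0%N.
by move=> _ [N _ <-].
Qed.

Lemma cabs_le_l2norm x n : in_l2 x -> cabs (x n) <= l2norm x.
Proof.
move=> xl2; rewrite -(@ler_pXn2r _ 2) ?nnegrE ?cabs_ge0 ?l2norm_ge0 //.
by apply: le_trans (psum2_le n.+1 xl2); rewrite psum2S lerDr psum2_ge0.
Qed.

Lemma vadd_le_l2norm x y : in_l2 x -> in_l2 y ->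
  in_l2 (vadd x y) /\ l2norm (vadd x y) <= l2norm x + l2norm y.
Proof.
move=> xl2 yl2.
(* [(a + b)^2 <= (1 + B/A) a^2 + (1 + A/B) b^2], summed, for [A], [B] just
   above the norms so that no division by zero occurs. *)
have key e : 0 < e -> in_l2 (vadd x y) /\
    l2norm (vadd x y) <= (l2norm x + e) + (l2norm y + e).
  move=> e0; set A := l2norm x + e; set B := l2norm y + e.
  have A0 : 0 < A by rewrite ltr_wpDl ?l2norm_ge0.
  have B0 : 0 < B by rewrite ltr_wpDl ?l2norm_ge0.
  apply: l2norm_le => [|N]; first by rewrite addr_ge0 ?ltW.
  have hX : psum2 x N <= A ^+ 2.
    apply: le_trans (psum2_le N xl2) _.
    by rewrite ler_sqr ?nnegrE ?l2norm_ge0 ?(ltW A0) // lerDl ltW.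
  have hY : psum2 y N <= B ^+ 2.
    apply: le_trans (psum2_le N yl2) _.
    by rewrite ler_sqr ?nnegrE ?l2norm_ge0 ?(ltW B0) // lerDl ltW.
  have step : psum2 (vadd x y) N <=
      (1 + B / A) * psum2 x N + (1 + A / B) * psum2 y N.
    rewrite /psum2 !mulr_sumr -big_split /=; apply: ler_sum => i _.
    have /= h := cabsD (x i) (y i).
    have h0 := cabs_ge0 (x i + y i).
    have : cabs (x i + y i) ^+ 2 <= (cabs (x i) + cabs (y i)) ^+ 2.
      by rewrite ler_sqr ?nnegrE ?addr_ge0 ?cabs_ge0.
    move/le_trans; apply.
    move: (cabs (x i)) (cabs (y i)) => u v.
    rewrite -subr_ge0.
    have -> : (1 + B / A) * u ^+ 2 + (1 + A / B) * v ^+ 2 - (u + v) ^+ 2 =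
       (B * u - A * v) ^+ 2 / (A * B).
      by field; rewrite !gt_eqF.
    by rewrite divr_ge0 ?sqr_ge0 ?mulr_ge0 ?ltW.
  apply: le_trans step _.
  have -> : (A + B) ^+ 2 = (1 + B / A) * A ^+ 2 + (1 + A / B) * B ^+ 2.
    by field; rewrite !gt_eqF.
  by apply: lerD; apply: ler_wpM2l => //; rewrite addr_ge0 ?divr_ge0 ?ltW.
split; first by have [] := key 1 ltr01.
apply/ler_addgt0Pr => e e0; have [|_ /le_trans-> //] := key (e / 2).
  by rewrite divr_gt0.
by lra.
Qed.

Lemma in_l2_vadd x y : in_l2 x -> in_l2 y -> in_l2 (vadd x y).
Proof. by move=> hx hy; have [] := vadd_le_l2norm hx hy. Qed.

Lemma l2norm_vadd x y : in_l2 x -> in_l2 y ->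
  l2norm (vadd x y) <= l2norm x + l2norm y.
Proof. by move=> hx hy; have [] := vadd_le_l2norm hx hy. Qed.

Lemma vscale_le_l2norm a x : in_l2 x ->
  in_l2 (vscale a x) /\ l2norm (vscale a x) <= cabs a * l2norm x.
Proof.
move=> xl2; apply: l2norm_le => [|N]; first by rewrite mulr_ge0 ?cabs_ge0 ?l2norm_ge0.
have -> : psum2 (vscale a x) N = cabs a ^+ 2 * psum2 x N.
  by rewrite /psum2 mulr_sumr; apply: eq_bigr => i _; rewrite cabsM exprMn.
by rewrite exprMn ler_wpM2l ?sqr_ge0 ?psum2_le.
Qed.

Lemma in_l2_vscale a x : in_l2 x -> in_l2 (vscale a x).
Proof. by move=> /(vscale_le_l2norm a)[]. Qed.

Lemma vscaleN1 x : vscale (-1) x = vopp x.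
Proof. by apply: funext => i; rewrite /vscale mulN1r. Qed.

Lemma in_l2_vopp x : in_l2 x -> in_l2 (vopp x).
Proof. by rewrite -vscaleN1; apply: in_l2_vscale. Qed.

Lemma l2norm_vopp x : in_l2 x -> l2norm (vopp x) <= l2norm x.
Proof.
move=> /(vscale_le_l2norm (-1))[_].
by rewrite vscaleN1 cabsN cabs1 mul1r.
Qed.

Lemma in_l2_vzero : in_l2 (@vzero R).
Proof.
exists 0 => N; rewrite /psum2 big1 // => i _.
by rewrite /vzero cabs0 expr0n.
Qed.

Lemma l2norm_vzero : l2norm (@vzero R) = 0.
Proof.
apply/eqP; rewrite eq_le l2norm_ge0 andbT.
have [|//] := @l2norm_le (@vzero R) 0 (lexx 0).
by move=> N; rewrite expr0n /psum2 big1 // => i _; rewrite /vzero cabs0 expr0n.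
Qed.

(** * Limits of complex sequences through real and imaginary parts *)

Definition ccvg (u : nat -> R[i]) (l : R[i]) : Prop :=
  (complex.Re (u N) @[N --> \oo] --> complex.Re l) /\
  (complex.Im (u N) @[N --> \oo] --> complex.Im l).

Definition clim (u : nat -> R[i]) : R[i] :=
  Complex (limn (fun N => complex.Re (u N))) (limn (fun N => complex.Im (u N))).

Lemma ccvg_clim u l : ccvg u l -> clim u = l.
Proof.
case: l => a b [/= ha hb]; rewrite /clim.
by congr Complex; apply: cvg_lim.
Qed.

Lemma ccvg_cst l : ccvg (fun=> l) l.
Proof. by split; apply: cvg_cst. Qed.

Lemma ccvgD u v l m : ccvg u l -> ccvg v m -> ccvg (fun N => u N + v N) (l + m).
Proof.
move=> [ur ui] [vr vi]; split.
  rewrite raddfD /=; under eq_fun do rewrite raddfD /=; exact: cvgD.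
by rewrite raddfD /=; under eq_fun do rewrite raddfD /=; exact: cvgD.
Qed.

Lemma ReM (z w : R[i]) : complex.Re (z * w) =
  complex.Re z * complex.Re w - complex.Im z * complex.Im w.
Proof. by case: z; case: w. Qed.

Lemma ImM (z w : R[i]) : complex.Im (z * w) =
  complex.Re z * complex.Im w + complex.Im z * complex.Re w.
Proof. by case: z; case: w. Qed.

Lemma ccvgM u v l m : ccvg u l -> ccvg v m -> ccvg (fun N => u N * v N) (l * m).
Proof.
move=> [ur ui] [vr vi]; split.
  by rewrite ReM; under eq_fun do rewrite ReM; apply: cvgB; apply: cvgM.
by rewrite ImM; under eq_fun do rewrite ImM; apply: cvgD; apply: cvgM.
Qed.

Lemma ccvgX u l m : ccvg u l -> ccvg (fun N => u N ^+ m) (l ^+ m).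
Proof.
move=> ul; elim: m => [|m IH]; first exact: ccvg_cst.
by rewrite exprS; under eq_fun do rewrite exprS; apply: ccvgM.
Qed.

(** The square of the modulus is a polynomial in the real and imaginary parts; bounds on moduli are
    passed to the limit in this form. *)
Lemma ccvg_cabs2 u l : ccvg u l -> cabs (u N) ^+ 2 @[N --> \oo] --> cabs l ^+ 2.
Proof.
move=> [ur ui]; rewrite sqr_cabs; under eq_fun do rewrite sqr_cabs.
by apply: cvgD; rewrite expr2; under eq_fun do rewrite expr2; apply: cvgM.
Qed.

Lemma ccvg_cabs_le u l M : ccvg u l -> (\forall N \near \oo, cabs (u N) <= M) ->
  cabs l <= M.
Proof.
move=> ul hM.
have M0 : 0 <= M.
  by case: hM => N _ /(_ N) /= /(_ (leqnn N)) /(le_trans _); apply; apply: cabs_ge0.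
rewrite -(@ler_pXn2r _ 2) ?nnegrE ?cabs_ge0 //.
apply: (closed_cvg _ (@closed_le R (M ^+ 2)) _ _ (ccvg_cabs2 ul)).
apply: filterS hM => N /= h.
by rewrite ler_sqr ?nnegrE ?cabs_ge0.
Qed.

(** The telescoping series is dominated by a geometric one, hence converges absolutely. *)
Lemma real_cvg_of_geometric_steps (u : nat -> R) C :
  (forall N, `|u N.+1 - u N| <= C * 2^-1 ^+ N) -> cvgn u.
Proof.
move=> h; have h1 : cvgn (series (telescope u)).
  apply: normed_cvg; apply: (@series_le_cvg _ _ (geometric C 2^-1)) => [N|N|N|].
  - exact: normr_ge0.
  - exact: le_trans (normr_ge0 _) (h N).
  - exact: h.
  by apply: is_cvg_geometric_series; rewrite ger0_norm ?invr_ge0 // invf_lt1 ?ltr1n.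
have -> : u = (fun N => u 0%N + series (telescope u) N).
  by apply: funext => N; rewrite -eq_sum_telescope.
by apply: is_cvgD => //; apply: is_cvg_cst.
Qed.

Lemma ccvg_of_geometric_steps u C :
  (forall N, cabs (u N.+1 - u N) <= C * 2^-1 ^+ N) -> ccvg u (clim u).
Proof.
move=> h; split; apply: real_cvg_of_geometric_steps => N.
  by apply: le_trans (h N); rewrite -raddfB; apply: ler_Re_cabs.
by apply: le_trans (h N); rewrite -raddfB; apply: ler_Im_cabs.
Qed.

(** A partial sum involves finitely many coordinates, so its bound survives a coordinatewise limit.
    Norm bounds thus reach the infinite product without norm convergence. *)
Lemma fatou_l2norm (u : nat -> cseq R) x M : 0 <= M ->
  (forall n, ccvg (fun N => u N n) (x n)) ->
  (forall N, in_l2 (u N)) -> (forall N, l2norm (u N) <= M) ->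
  in_l2 x /\ l2norm x <= M.
Proof.
move=> M0 ux ul2 uM; apply: l2norm_le => // K.
have hc : psum2 (u N) K @[N --> \oo] --> psum2 x K.
  elim: K => [|K IH].
    by rewrite /psum2 big_ord0; under eq_fun do rewrite big_ord0; apply: cvg_cst.
  rewrite psum2S; under eq_fun do rewrite psum2S.
  by apply: cvgD => //; apply: ccvg_cabs2.
apply: (closed_cvg _ (@closed_le R (M ^+ 2)) _ _ hc).
apply: nearW => N /=.
apply: le_trans (psum2_le K (ul2 N)) _.
by rewrite ler_sqr ?nnegrE ?l2norm_ge0.
Qed.

End SequenceSpace.

(** * Binary digits of natural numbers as codes of finite sets *)

Fixpoint bit (i n : nat) : bool := if i is j.+1 then bit j n./2 else odd n.

Lemma bit_leq i n : bit i n -> (2 ^ i <= n)%N.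
Proof.
elim: i n => [|i IH] n /=; first by case: n.
move=> /IH h; rewrite expnS mul2n -[leqRHS]odd_double_half.
by apply: leq_trans (leq_addl _ _); rewrite leq_double.
Qed.

(** No carry occurs when the digit at [i] is 0, so adding [2 ^ i] inserts [i] into the coded set. *)
Lemma bit_addX i n : ~~ bit i n -> forall j, bit j (n + 2 ^ i) = (j == i) || bit j n.
Proof.
elim: i n => [|i IH] n /= h j.
  rewrite expn0 addn1; case: j => [|j] /=; first by rewrite h.
  by rewrite uphalf_half (negbTE h).
have e : (n + 2 ^ i.+1)./2 = (n./2 + 2 ^ i)%N.
  by rewrite halfD expnS mul2n odd_double andbF doubleK.
case: j => [|j] /=; last by rewrite e IH.
by rewrite oddD expnS mul2n odd_double addbF.
Qed.

(** Halving reduces to the higher digits, after which the lowest digits are compared. *)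
Lemma bit_sub_leq m n : (forall i, bit i m -> bit i n) -> (m <= n)%N.
Proof.
elim/ltn_ind: m n => -[//|m] IH n h.
have h2 : (m.+1./2 <= n./2)%N.
  apply: IH => [|i]; first by rewrite -divn2 ltn_Pdiv.
  exact: (h i.+1).
rewrite -(odd_double_half m.+1) -(odd_double_half n).
apply: leq_add; last by rewrite leq_double.
by have /= := h 0%N; case: odd => // ->.
Qed.

(** * The operators P_i, their common eigenvectors and products of factors *)

Section Operators.
Variable R : realType.
Implicit Types (x y : cseq R) (e : nat -> bool) (c : nat -> R[i]).

(* A natural number stands for the finite set of its binary digits. In the
   space of functions [e |-> <evec e, x>] on the Cantor set, [bitproj i] is the
   transpose of multiplication by the coordinate [e i]. *)
Definition evec e : cseq R :=
  fun n => if `[< forall i, bit i n -> e i >] then 2^-1 ^+ n else 0.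

Definition bitproj i x : cseq R :=
  fun n => if bit i n then x n else 2 ^+ (2 ^ i) * x (n + 2 ^ i)%N.

Definition bitproj_bound i : R := 1 + 2 ^+ (2 ^ i).

Definition factor i (a : R[i]) x : cseq R := vadd x (vscale (a - 1) (bitproj i x)).

Fixpoint finprod c N x : cseq R :=
  if N is M.+1 then factor M (c M) (finprod c M x) else x.

Definition infprod c x : cseq R := fun n => clim (fun N => finprod c N x n).

Definition eigval c e N : R[i] := \prod_(i < N) (if e i then c i else 1).

Definition limeigval c e : R[i] := clim (eigval c e).

Lemma bitproj_bound_gt0 i : 0 < bitproj_bound i.
Proof. by rewrite ltr_pwDl ?exprn_ge0. Qed.

Lemma natr_complex (m : nat) : m%:R = real_complex R m%:R.
Proof. by rewrite rmorph_nat. Qed.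

Lemma evec0 e : evec e 0%N = 1.
Proof.
rewrite /evec; case: asboolP => // -[] i.
by move/bit_leq; rewrite leqNgt expn_gt0.
Qed.

(** At an index containing [i], a nonzero entry forces [e i]. At any other [n], the entry at
    [n + 2 ^ i] is [2^-1 ^+ (2 ^ i)] times the entry at [n] if [e i] holds and 0 otherwise; the
    weight in [bitproj] cancels this power. *)
Lemma bitproj_evec i e : bitproj i (evec e) = if e i then evec e else @vzero R.
Proof.
apply: funext => n; rewrite (fun_if (fun f => f n)) /bitproj /evec /vzero.
case: ifPn => hn.
  by case: asboolP => [h|_]; [rewrite (h _ hn) | case: (e i)].
have -> : `[< forall j, bit j (n + 2 ^ i) -> e j >] =
          e i && `[< forall j, bit j n -> e j >].
  apply/asboolP/andP => [h|[ei /asboolP h] j].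
    split; first by apply: h; rewrite bit_addX // eqxx.
    by apply/asboolP => j hj; apply: h; rewrite bit_addX // hj orbT.
  by rewrite bit_addX // => /orP[/eqP->|/h].
case: (e i) => /=; last by rewrite mulr0.
case: asboolP => _; last by rewrite mulr0.
by rewrite exprD mulrCA -exprMn divff ?expr1n ?mulr1 // pnatr_eq0.
Qed.

(** The kept entries contribute at most the squared norm of [x], the shifted ones at most [Q ^+ 2]
    times it, and 1 + Q^2 <= (1 + Q)^2. *)
Lemma bitproj_l2 i x : in_l2 x ->
  in_l2 (bitproj i x) /\ l2norm (bitproj i x) <= bitproj_bound i * l2norm x.
Proof.
move=> xl2; set Q : R := 2 ^+ (2 ^ i).
have Q0 : 0 <= Q by rewrite exprn_ge0.
apply: l2norm_le => [|N]; first by rewrite mulr_ge0 ?l2norm_ge0 ?(ltW (bitproj_bound_gt0 i)).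
have h : psum2 (bitproj i x) N <= psum2 x N + Q ^+ 2 * psum2 x (2 ^ i + N).
  apply: (@le_trans _ _ (psum2 x N + Q ^+ 2 * \sum_(k < N) cabs (x (2 ^ i + k)%N) ^+ 2)).
    rewrite mulr_sumr /psum2 -big_split /=; apply: ler_sum => k _.
    rewrite /bitproj; case: ifP => _; first by rewrite lerDl mulr_ge0 ?sqr_ge0.
    have -> : cabs (2 ^+ (2 ^ i) * x (k + 2 ^ i)%N) = Q * cabs (x (2 ^ i + k)%N).
      by rewrite cabsM addnC natr_complex -rmorphXn cabs_real ger0_norm.
    by rewrite exprMn lerDr sqr_ge0.
  rewrite lerD2l ler_wpM2l ?sqr_ge0 // /psum2 big_split_ord /= lerDr.
  by apply: sumr_ge0 => k _; rewrite sqr_ge0.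
apply: le_trans h _.
have h1 := psum2_le N xl2; have h2 := psum2_le (2 ^ i + N)%N xl2.
have : psum2 x N + Q ^+ 2 * psum2 x (2 ^ i + N) <= l2norm x ^+ 2 + Q ^+ 2 * l2norm x ^+ 2.
  by rewrite lerD // ler_wpM2l ?sqr_ge0.
move/le_trans; apply; rewrite exprMn -[X in X + _]mul1r -mulrDl ler_wpM2r ?sqr_ge0 //.
by rewrite /bitproj_bound -/Q; nra.
Qed.

Lemma factor_l2 i a x : in_l2 x -> in_l2 (factor i a x) /\
  l2norm (factor i a x) <= (1 + cabs (a - 1) * bitproj_bound i) * l2norm x.
Proof.
move=> xl2; have [pl2 pn] := bitproj_l2 i xl2.
have [sl2 sn] := vscale_le_l2norm (a - 1) pl2.
split; first exact: in_l2_vadd.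
apply: le_trans (l2norm_vadd xl2 sl2) _; rewrite mulrDl mul1r lerD2l.
by apply: le_trans sn _; rewrite -mulrA ler_wpM2l ?cabs_ge0.
Qed.

Lemma finprod_linear c N a x y : finprod c N (vadd (vscale a x) y) =
  vadd (vscale a (finprod c N x)) (finprod c N y).
Proof.
elim: N => [//|N IH] /=; rewrite IH.
apply: funext => n; rewrite /factor /bitproj /vadd /vscale.
by case: ifP => _; ring.
Qed.

Lemma finprod_evec c N e : finprod c N (evec e) = vscale (eigval c e N) (evec e).
Proof.
have bz i a x : bitproj i (vscale a x) = vscale a (bitproj i x).
  by apply: funext => n; rewrite /bitproj /vscale; case: ifP => _; ring.
rewrite /eigval; elim: N => [|N IH] /=.
  by rewrite big_ord0; apply: funext => n; rewrite /vscale mul1r.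
rewrite IH big_ord_recr /= /factor bz bitproj_evec; apply: funext => n.
by rewrite /vadd /vscale /vzero; case: (e N); ring.
Qed.

Lemma l2norm_geometric_tail x m : (forall n, (n < m)%N -> x n = 0) ->
  (forall n, cabs (x n) <= 2^-1 ^+ n) -> in_l2 x /\ l2norm x <= 2 * 2^-1 ^+ m.
Proof.
move=> x0 xn.
(* The geometric sum of ratio 1/4 in closed form, so that the induction is exact; 4/3 is finally
   rounded up to 4 = 2^2. *)
have h j : psum2 x (m + j) <= 4 / 3 * ((2^-1 ^+ m) ^+ 2 - (2^-1 ^+ (m + j)) ^+ 2).
  elim: j => [|j IH].
    rewrite addn0 subrr mulr0 /psum2 big1 // => k _.
    by rewrite x0 // cabs0 expr0n.
  rewrite addnS psum2S.
  have h2 : cabs (x (m + j)%N) ^+ 2 <= (2^-1 ^+ (m + j)) ^+ 2.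
    by rewrite ler_sqr ?nnegrE ?cabs_ge0 ?exprn_ge0 ?invr_ge0.
  rewrite (exprS _ (m + j)) exprMn; set q := (2^-1 ^+ (m + j)) ^+ 2 in IH h2 *.
  set p := (2^-1 ^+ m) ^+ 2 in IH *.
  apply: le_trans (lerD IH h2) _.
  by lra.
apply: l2norm_le => [|N]; first by rewrite mulr_ge0 ?exprn_ge0 ?invr_ge0.
apply: (@le_trans _ _ (psum2 x (m + N))).
  by rewrite addnC /psum2 big_split_ord /= lerDl sumr_ge0 // => k _; rewrite sqr_ge0.
apply: le_trans (h N) _; rewrite exprMn.
have := sqr_ge0 (2^-1 ^+ (m + N) : R); have := sqr_ge0 (2^-1 ^+ m : R).
by lra.
Qed.

Lemma cabs_invX2 n : cabs (2^-1 ^+ n : R[i]) = 2^-1 ^+ n.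
Proof.
by rewrite natr_complex -fmorphV -rmorphXn cabs_real ger0_norm ?exprn_ge0 ?invr_ge0.
Qed.

Lemma evec_l2 e : in_l2 (evec e).
Proof.
have [//||//] := @l2norm_geometric_tail (evec e) 0.
move=> n; rewrite /evec; case: asboolP => _; first by rewrite cabs_invX2.
by rewrite cabs0 exprn_ge0 ?invr_ge0.
Qed.

(** An index n < m codes only digits i < m, since i < 2^i <= n; the two vectors therefore agree
    below [m] and differ by a geometric tail. *)
Lemma evec_continuous e f m : (forall i, (i < m)%N -> e i = f i) ->
  l2norm (vadd (evec e) (vopp (evec f))) <= 2 * 2^-1 ^+ m.
Proof.
move=> ef; have [||//] := @l2norm_geometric_tail (vadd (evec e) (vopp (evec f))) m.
  move=> n nm; rewrite /vadd /vopp /evec.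
  suff -> : `[< forall i, bit i n -> e i >] = `[< forall i, bit i n -> f i >].
    by rewrite subrr.
  apply/asboolP/asboolP => h i bi; have := h i bi; rewrite ef //;
    apply: leq_ltn_trans nm; apply: leq_trans (bit_leq bi); apply: ltnW; exact: ltn_expl.
move=> n; rewrite /vadd /vopp /evec.
case: asboolP => _; case: asboolP => _;
  by rewrite ?subrr ?subr0 ?sub0r ?cabsN ?cabs_invX2 ?cabs0 ?exprn_ge0 ?invr_ge0.
Qed.

(** * Norm bounds and convergence of the infinite product *)

Section SmallFactors.
Variables (delta : R) (delta_gt0 : 0 < delta).

(** The left side bounds the norm of the i-th factor minus the identity. The right sides add up to s
    = delta / (1 + delta), and 1 / (1 - s) = 1 + delta bounds the product of the norms. *)
Definition small c := forall i,
  cabs (c i - 1) * bitproj_bound i <= delta * 2^-1 ^+ i.+1 / (1 + delta).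

(* The bound is an invariant of the product, since
   [(1 + d (1 - q)) (1 + d q / 2 / (1 + d)) <= 1 + d (1 - q / 2)]. *)
Lemma finprod_l2 c N x : small c -> in_l2 x -> in_l2 (finprod c N x) /\
  l2norm (finprod c N x) <= (1 + delta * (1 - 2^-1 ^+ N)) * l2norm x.
Proof.
move=> sc xl2; elim: N => [|N [IH1 IH2]] /=.
  by rewrite expr0 subrr mulr0 addr0 mul1r.
have [fl2 fn] := factor_l2 N (c N) IH1; split=> //.
apply: le_trans fn _.
set q : R := 2^-1 ^+ N in IH2 *.
have q0 : 0 <= q by rewrite exprn_ge0 ?invr_ge0.
have q1 : q <= 1 by rewrite exprn_ile1 ?invr_ge0 // invf_le1 ?ler1n.
have sN := sc N; rewrite exprS -/q in sN *.
set g := cabs _ * _ in sN *.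
have g0 : 0 <= g by rewrite mulr_ge0 ?cabs_ge0 ?(ltW (bitproj_bound_gt0 _)).
apply: le_trans (ler_wpM2l _ IH2) _; first by rewrite addr_ge0.
rewrite mulrA ler_wpM2r ?l2norm_ge0 //.
have d1 : 0 < 1 + delta by rewrite addr_gt0.
have h1 : g * (1 + delta * (1 - q)) <= g * (1 + delta).
  by rewrite ler_wpM2l // lerD2l ler_piMr ?(ltW delta_gt0) // gerBl.
have h2 : g * (1 + delta) <= delta * (2^-1 * q).
  by rewrite -ler_pdivlMr.
by lra.
Qed.

Lemma finprod_l2norm c N x : small c -> in_l2 x ->
  l2norm (finprod c N x) <= (1 + delta) * l2norm x.
Proof.
move=> sc xl2; have [_ /le_trans] := finprod_l2 N sc xl2; apply.
by rewrite ler_wpM2r ?l2norm_ge0 // lerD2l ler_piMr ?(ltW delta_gt0) // gerBl ?exprn_ge0 ?invr_ge0.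
Qed.

(** Consecutive products differ by (c_N - 1) P_N applied to a vector of norm at most (1 + delta)
    times that of [x]; the denominator in [small] cancels this factor and leaves a geometric
    bound. *)
Lemma infprod_cvg c x n : small c -> in_l2 x ->
  ccvg (fun N => finprod c N x n) (infprod c x n).
Proof.
move=> sc xl2; apply: (@ccvg_of_geometric_steps _ _ (delta * l2norm x)) => N /=.
have [fl2 _] := finprod_l2 N sc xl2; have fn := finprod_l2norm N sc xl2.
rewrite /factor /vadd /vscale addrAC subrr add0r cabsM.
have [pl2 pn] := bitproj_l2 N fl2.
have h : cabs (bitproj N (finprod c N x) n) <=
    bitproj_bound N * ((1 + delta) * l2norm x).
  apply: le_trans (cabs_le_l2norm n pl2) _; apply: le_trans pn _.
  by rewrite ler_wpM2l ?(ltW (bitproj_bound_gt0 _)).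
apply: le_trans (ler_wpM2l (cabs_ge0 _) h) _.
have d1 : 0 < 1 + delta by rewrite addr_gt0.
rewrite !mulrA [leRHS]mulrAC ler_wpM2r ?l2norm_ge0 // -ler_pdivlMr //.
apply: le_trans (sc N) _.
rewrite ler_wpM2r ?invr_ge0 ?(ltW d1) // ler_wpM2l ?(ltW delta_gt0) //.
by rewrite exprS ler_piMl ?exprn_ge0 ?invr_ge0 // invf_le1 ?ler1n.
Qed.

Lemma infprod_l2 c x : small c -> in_l2 x ->
  in_l2 (infprod c x) /\ l2norm (infprod c x) <= (1 + delta) * l2norm x.
Proof.
move=> sc xl2; apply: (@fatou_l2norm _ (fun N => finprod c N x)).
- by rewrite mulr_ge0 ?l2norm_ge0 ?addr_ge0 ?(ltW delta_gt0).
- by move=> n; apply: infprod_cvg.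
- by move=> N; have [] := finprod_l2 N sc xl2.
- by move=> N; apply: finprod_l2norm.
Qed.

Lemma infprod_linear c a x y : small c -> in_l2 x -> in_l2 y ->
  infprod c (vadd (vscale a x) y) = vadd (vscale a (infprod c x)) (infprod c y).
Proof.
move=> sc xl2 yl2; apply: funext => n; apply: ccvg_clim.
under eq_fun do rewrite finprod_linear.
by apply: ccvgD; [apply: ccvgM; [apply: ccvg_cst|]|]; apply: infprod_cvg.
Qed.

(** Entry 0 of [evec e] is 1, so the partial eigenvalues are entry 0 of the finite products applied
    to [evec e]. *)
Lemma eigval_cvg c e : small c -> ccvg (eigval c e) (limeigval c e).
Proof.
move=> sc.
have h : ccvg (fun N => finprod c N (evec e) 0%N) (infprod c (evec e) 0%N).
  by apply: infprod_cvg => //; apply: evec_l2.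
have E : (fun N => finprod c N (evec e) 0%N) = eigval c e.
  by apply: funext => N; rewrite finprod_evec /vscale evec0 mulr1.
by rewrite /limeigval -E.
Qed.

Lemma infprod_evec c e : small c ->
  infprod c (evec e) = vscale (limeigval c e) (evec e).
Proof.
move=> sc; apply: funext => n; apply: ccvg_clim.
under eq_fun do rewrite finprod_evec.
by apply: ccvgM; [apply: eigval_cvg|apply: ccvg_cst].
Qed.

End SmallFactors.
End Operators.

(** * Linear spans and their closures in l_2 *)

Section ClosedSpan.
Variable R : realType.
Implicit Types (x y z : cseq R) (S : set (cseq R)).

(** The inductive form lets statements about linear maps on the span be proved by induction;
    [lspan_lincomb] converts to indexed sums. *)
Inductive lspan S : cseq R -> Prop :=
| lspan0 : lspan S (@vzero R)
| lspanZD a x y : S x -> lspan S y -> lspan S (vadd (vscale a x) y).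

Definition cspan S y : Prop := in_l2 y /\ forall eps : R, 0 < eps ->
  exists2 z, lspan S z & l2norm (vadd y (vopp z)) < eps.

Lemma lspan_lincomb S z : lspan S z -> exists n (c : 'I_n -> R[i]) xs,
  (forall j, S (xs j)) /\ z = lincomb c xs.
Proof.
elim=> [|a x y Sx _ [n [c [xs [Sxs ->]]]]].
  exists 0%N, (fun=> 0), (fun=> @vzero R); split; first by case.
  by apply: funext => i; rewrite /lincomb big_ord0.
exists n.+1, (fun j => if unlift ord0 j is Some k then c k else a),
  (fun j => if unlift ord0 j is Some k then xs k else x); split.
  by move=> j; case: unliftP.
apply: funext => i; rewrite /lincomb big_ord_recl /= unlift_none.
by congr (_ + _); apply: eq_bigr => j _; rewrite liftK.
Qed.

Lemma dense_span_of_cspan S : (forall y, in_l2 y -> cspan S y) -> dense_span S.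
Proof.
move=> h y /h[_ {}h] eps /h[z /lspan_lincomb[n [c [xs [Sxs ->]]]] zeps].
by exists n, c, xs.
Qed.

Section ClosureProperties.
Variables (S : set (cseq R)) (Sl2 : forall x, S x -> in_l2 x).

Lemma lspan_l2 z : lspan S z -> in_l2 z.
Proof.
elim=> [|a x y Sx _ yl2]; first exact: in_l2_vzero.
by apply: in_l2_vadd => //; apply: in_l2_vscale; apply: Sl2.
Qed.

Lemma lspanD y z : lspan S y -> lspan S z -> lspan S (vadd y z).
Proof.
move=> + Sz; elim=> [|a x w Sx _ IH].
  by rewrite (_ : vadd _ _ = z) //; apply: funext => i; rewrite /vadd add0r.
rewrite (_ : vadd _ _ = vadd (vscale a x) (vadd w z)); first exact: lspanZD.
by apply: funext => i; rewrite /vadd addrA.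
Qed.

Lemma lspanZ a z : lspan S z -> lspan S (vscale a z).
Proof.
elim=> [|b x w Sx _ IH].
  by rewrite (_ : vscale _ _ = @vzero R);
    [exact: lspan0 | apply: funext => i; rewrite /vscale mulr0].
rewrite (_ : vscale _ _ = vadd (vscale (a * b) x) (vscale a w)); first exact: lspanZD.
by apply: funext => i; rewrite /vadd /vscale mulrDr mulrA.
Qed.

Lemma cspan_lspan z : lspan S z -> cspan S z.
Proof.
move=> Sz; split; first exact: lspan_l2.
move=> eps e0; exists z => //.
rewrite (_ : vadd _ _ = @vzero R) ?l2norm_vzero //.
by apply: funext => i; rewrite /vadd /vopp subrr.
Qed.

Lemma cspan_sub x : S x -> cspan S x.
Proof.
move=> Sx; apply: cspan_lspan.
rewrite (_ : x = vadd (vscale 1 x) (@vzero R)).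
  by apply: lspanZD => //; apply: lspan0.
by apply: funext => i; rewrite /vadd /vscale mul1r addr0.
Qed.

Lemma cspan_closed y : in_l2 y ->
  (forall eps : R, 0 < eps -> exists2 z, cspan S z & l2norm (vadd y (vopp z)) < eps) ->
  cspan S y.
Proof.
move=> yl2 h; split=> // eps e0.
have e2 : 0 < eps / 2 by rewrite divr_gt0.
have [z [zl2 /(_ _ e2)[w Sw zw]] yz] := h _ e2.
exists w => //.
rewrite (_ : vadd _ _ = vadd (vadd y (vopp z)) (vadd z (vopp w))).
  have wl2 := lspan_l2 Sw.
  apply: le_lt_trans (l2norm_vadd _ _) _; try by apply: in_l2_vadd => //; apply: in_l2_vopp.
  by rewrite [ltRHS]splitr ltrD.
by apply: funext => i; rewrite /vadd /vopp; ring.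
Qed.

Lemma cspanD y z : cspan S y -> cspan S z -> cspan S (vadd y z).
Proof.
move=> [yl2 hy] [zl2 hz]; split; first exact: in_l2_vadd.
move=> eps e0; have e2 : 0 < eps / 2 by rewrite divr_gt0.
have [u Su yu] := hy _ e2; have [v Sv zv] := hz _ e2.
exists (vadd u v); first exact: lspanD.
rewrite (_ : vadd _ _ = vadd (vadd y (vopp u)) (vadd z (vopp v))).
  apply: le_lt_trans (l2norm_vadd _ _) _; last by rewrite [ltRHS]splitr ltrD.
    by apply: in_l2_vadd => //; apply/in_l2_vopp/lspan_l2.
  by apply: in_l2_vadd => //; apply/in_l2_vopp/lspan_l2.
by apply: funext => i; rewrite /vadd /vopp; ring.
Qed.

Lemma cspanZ a y : cspan S y -> cspan S (vscale a y).
Proof.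
move=> [yl2 hy]; split; first exact: in_l2_vscale.
move=> eps e0; have a1 : 0 < cabs a + 1 by rewrite ltr_wpDl ?cabs_ge0.
have [u Su yu] := hy _ (divr_gt0 e0 a1).
exists (vscale a u); first exact: lspanZ.
rewrite (_ : vadd _ _ = vscale a (vadd y (vopp u))).
  have ul2 := lspan_l2 Su.
  have [_ h] := vscale_le_l2norm a (in_l2_vadd yl2 (in_l2_vopp ul2)).
  apply: le_lt_trans h _; apply: (@le_lt_trans _ _ ((cabs a + 1) * l2norm (vadd y (vopp u)))).
    by rewrite ler_wpM2r ?l2norm_ge0 // lerDl.
  by rewrite mulrC -ltr_pdivlMr.
by apply: funext => i; rewrite /vadd /vopp /vscale; ring.
Qed.

Definition basis (n : nat) : cseq R := fun k => (k == n)%:R.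

Definition trunc (N : nat) y : cseq R := fun k => if (k < N)%N then y k else 0.

Lemma cspan_trunc N y : (forall k, (k < N)%N -> cspan S (basis k)) ->
  cspan S (trunc N y).
Proof.
elim: N => [|N IH] h.
  by rewrite (_ : trunc 0 y = @vzero R) //; apply/cspan_lspan/lspan0.
rewrite (_ : trunc N.+1 y = vadd (vscale (y N) (basis N)) (trunc N y)).
  apply: cspanD; first by apply: cspanZ; apply: h.
  by apply: IH => k kN; apply: h; rewrite ltnW.
apply: funext => k; rewrite /trunc /vadd /vscale /basis ltnS leq_eqVlt.
have [->|_] /= := eqVneq k N; first by rewrite ltnn mulr1 addr0.
by rewrite mulr0 add0r.
Qed.

(** The remainder has partial sums [psum2 y (N + K) - psum2 y N], small once [psum2 y N] is close to
    the supremum. Halving [eps] makes the final inequality strict. *)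
Lemma l2norm_sub_trunc y (eps : R) : in_l2 y -> 0 < eps ->
  exists N, l2norm (vadd y (vopp (trunc N y))) < eps.
Proof.
move=> yl2 e0; have d0 : 0 < (eps / 2) ^+ 2 by rewrite exprn_gt0 ?divr_gt0.
have [_ [N _ <-] hN] := sup_adherent d0 (in_l2_has_sup yl2).
exists N; apply: (@le_lt_trans _ _ (eps / 2)); last by rewrite ltr_pdivrMr // mulr_natr mulr2n ltrDl.
have [||//] := @l2norm_le _ (vadd y (vopp (trunc N y))) (eps / 2).
  by rewrite divr_ge0 ?ltW.
move=> K; apply: (@le_trans _ _ (psum2 (vadd y (vopp (trunc N y))) (N + K))).
  rewrite addnC /psum2 big_split_ord /= lerDl.
  by apply: sumr_ge0 => k _; rewrite sqr_ge0.
have h := psum2_le_l2sq (N + K)%N yl2.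
have : psum2 (vadd y (vopp (trunc N y))) (N + K) = psum2 y (N + K) - psum2 y N.
  rewrite /psum2 !big_split_ord /= addrAC subrr add0r big1 ?add0r.
    apply: eq_bigr => k _.
    by rewrite /vadd /vopp /trunc ltnNge leq_addr /= oppr0 addr0.
  by move=> k _; rewrite /vadd /vopp /trunc ltn_ord subrr cabs0 expr0n.
move=> ->; rewrite -/(l2sq y) in hN.
by lra.
Qed.

Lemma cspan_full : (forall n, cspan S (basis n)) -> forall y, in_l2 y -> cspan S y.
Proof.
move=> h y yl2; apply: cspan_closed => // eps e0.
have [N hN] := l2norm_sub_trunc yl2 e0.
by exists (trunc N y) => //; apply: cspan_trunc.
Qed.

(* The vector [evec (bit^~ n)] is supported in [0, n] and has a nonzero entry
   at [n], so the system is triangular with respect to the basis. *)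
Lemma cspan_of_evec_dense :
  (forall e m, exists2 f, S (evec R f) & forall i, (i < m)%N -> e i = f i) ->
  forall y, in_l2 y -> cspan S y.
Proof.
move=> dS.
have hE e : cspan S (evec R e).
  apply: cspan_closed => [|eps e0]; first exact: evec_l2.
  have [m hm] : exists m, 2 * 2^-1 ^+ m < eps.
    have h : (2 * 2^-1 ^+ N : R) @[N --> \oo] --> (2 * 0 : R).
      apply: cvgM; first exact: cvg_cst.
      by apply: cvg_expr; rewrite ger0_norm ?invr_ge0 // invf_lt1 ?ltr1n.
    rewrite mulr0 in h; have [m _ /(_ m) /= hm] := cvgr_lt _ h _ e0.
    by exists m; apply: hm.
  have [f Sf ef] := dS e m; exists (evec R f); first exact: cspan_sub.
  exact: le_lt_trans (evec_continuous R ef) hm.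
apply: cspan_full; elim/ltn_ind => n IH.
rewrite (_ : basis n = vscale (2 ^+ n) (vadd (evec R (bit^~ n))
    (vscale (-1) (trunc n (evec R (bit^~ n)))))).
  by apply: cspanZ; apply: cspanD => //; apply: cspanZ; apply: cspan_trunc.
apply: funext => k; rewrite /basis /vscale /vadd /trunc.
have [kn|nk|->] := ltngtP k n.
- by rewrite mulN1r subrr mulr0.
- rewrite /evec asboolF ?mulr0 ?addr0 ?mulr0 // => /bit_sub_leq.
  by rewrite leqNgt nk.
- rewrite mulr0 addr0 /evec asboolT // -exprMn divff ?expr1n // pnatr_eq0.
Qed.

End ClosureProperties.
End ClosedSpan.

(** * Powers of the infinite product *)

Section Iterates.
Variables (R : realType) (delta : R) (c : nat -> R[i]).
Hypotheses (delta_gt0 : 0 < delta) (sc : small delta c).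
Implicit Types x y z : cseq R.

Let T : cseq R -> cseq R := infprod c.

(** This bound grows with [m] and serves only as continuity of the power; the uniform bound comes
    from the span of the eigenvectors. *)
Lemma iter_infprod_l2 m x : in_l2 x -> in_l2 (iter m T x) /\
  l2norm (iter m T x) <= (1 + delta) ^+ m * l2norm x.
Proof.
move=> xl2; elim: m => [|m [IH1 IH2]] /=; first by rewrite mul1r.
have [h1 h2] := infprod_l2 delta_gt0 sc IH1; split=> //.
apply: le_trans h2 _; rewrite exprS -mulrA ler_wpM2l //.
by rewrite addr_ge0 ?(ltW delta_gt0).
Qed.

Lemma iter_infprod_linear m a x y : in_l2 x -> in_l2 y ->
  iter m T (vadd (vscale a x) y) = vadd (vscale a (iter m T x)) (iter m T y).
Proof.
move=> xl2 yl2; elim: m => [//|m IH] /=; rewrite IH.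
by apply: (infprod_linear delta_gt0 a sc); apply: (proj1 (iter_infprod_l2 m _)).
Qed.

Lemma iter_infprod_evec m e :
  iter m T (evec R e) = vscale (limeigval c e ^+ m) (evec R e).
Proof.
elim: m => [|m IH] /=; first by apply: funext => n; rewrite /vscale mul1r.
(* Linearity is available for a x + y, so a multiple of [evec e] is written with the summand 0 x,
   and 0 x in turn as (-1) x + x. *)
rewrite (_ : iter m T (evec R e) =
  vadd (vscale (limeigval c e ^+ m) (evec R e)) (vscale 0 (evec R e))).
  rewrite /T (infprod_linear delta_gt0 _ sc) ?(infprod_evec delta_gt0 e sc);
    [|exact: evec_l2|by apply: in_l2_vscale; apply: evec_l2].
  rewrite (_ : infprod c (vscale 0 (evec R e)) = @vzero R).
    by apply: funext => n; rewrite /vadd /vscale /vzero exprS; ring.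
  rewrite (_ : vscale 0 (evec R e) = vadd (vscale (-1) (evec R e)) (evec R e)).
    rewrite (infprod_linear delta_gt0 _ sc); try exact: evec_l2.
    by apply: funext => n; rewrite /vadd /vscale /vzero; ring.
  by apply: funext => n; rewrite /vadd /vscale; ring.
by rewrite IH; apply: funext => n; rewrite /vadd /vscale; ring.
Qed.

Lemma eigvalX m e N : eigval (fun i => c i ^+ m) e N = eigval c e N ^+ m.
Proof.
rewrite /eigval -prodrXl; apply: eq_bigr => i _.
by case: (e i); rewrite ?expr1n.
Qed.

(** On [evec e] the products with multipliers c_i^m have eigenvalues [eigval c e N ^+ m], which tend
    to the eigenvalue of the m-th power of [T]; linearity extends this to the span. *)
Lemma iter_infprod_cvg m z : lspan (range (@evec R)) z -> forall n,
  ccvg (fun N => finprod (fun i => c i ^+ m) N z n) (iter m T z n).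
Proof.
have v0 : @vzero R = vadd (vscale (-1) (@vzero R)) (@vzero R).
  by apply: funext => n; rewrite /vadd /vscale /vzero mulr0 addr0.
elim=> [n|a x y [e _ <-] Sy IH n].
  rewrite (_ : iter m T (@vzero R) n = 0); last first.
    rewrite v0 iter_infprod_linear; try exact: in_l2_vzero.
    by rewrite /vadd /vscale mulN1r addNr.
  rewrite (_ : (fun N => _) = fun=> 0); first exact: ccvg_cst.
  apply: funext => N; rewrite v0 finprod_linear.
  by rewrite /vadd /vscale mulN1r addNr.
rewrite iter_infprod_linear; [|exact: evec_l2|]; last first.
  by apply: lspan_l2 Sy => _ [f _ <-]; apply: evec_l2.
under eq_fun do rewrite finprod_linear finprod_evec eigvalX.
rewrite iter_infprod_evec; apply: ccvgD; last exact: IH.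
apply: ccvgM; first exact: ccvg_cst.
apply: ccvgM; last exact: ccvg_cst.
exact/ccvgX/(eigval_cvg delta_gt0 e sc).
Qed.

(** Write x = z + w with [z] in the span and [w] small. The products with multipliers c_i^m bound
    the image of [z] by 1 + delta, uniformly in [m]; the crude bound is spent on [w] only. *)
Lemma iter_infprod_opnorm m : small delta (fun i => c i ^+ m) ->
  opnorm_le (iter m T) (1 + delta).
Proof.
move=> scm x xl2; set M := 1 + delta.
have M0 : 0 <= M by rewrite addr_ge0 ?(ltW delta_gt0).
apply/ler_addgt0Pr => eps e0.
(* The error is M^m |w| from the image of [w] plus M |w| from |z| <= |x| + |w|. *)
have K0 : 0 < M + M ^+ m by rewrite ltr_pwDl ?exprn_ge0 // addr_gt0.
have evl2 y : range (@evec R) y -> in_l2 y by move=> [f _ <-]; apply: evec_l2.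
have [_ /(_ _ (divr_gt0 e0 K0))[z Sz]] :
    cspan (range (@evec R)) x.
  apply: cspan_of_evec_dense => // e m'; exists e => //; by exists e.
have zl2 := lspan_l2 evl2 Sz.
set w := vadd x (vopp z) => wlt.
have wl2 : in_l2 w by apply: in_l2_vadd => //; apply: in_l2_vopp.
have [_ Tw] := iter_infprod_l2 m wl2.
have [_ Tz] : in_l2 (iter m T z) /\ l2norm (iter m T z) <= M * l2norm z.
  apply: (@fatou_l2norm _ (fun N => finprod (fun i => c i ^+ m) N z)).
  - by rewrite mulr_ge0 ?l2norm_ge0.
  - exact: iter_infprod_cvg.
  - by move=> N; have [] := finprod_l2 delta_gt0 N scm zl2.
  - by move=> N; apply: finprod_l2norm.
have zx : l2norm z <= l2norm x + l2norm w.
  rewrite (_ : z = vadd x (vopp w)).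
    by apply: le_trans (l2norm_vadd xl2 (in_l2_vopp wl2)) _; rewrite lerD2l l2norm_vopp.
  by apply: funext => n; rewrite /w /vadd /vopp; ring.
have -> : iter m T x = vadd (vscale 1 (iter m T w)) (iter m T z).
  rewrite -iter_infprod_linear //; congr iter.
  by apply: funext => n; rewrite /w /vadd /vopp /vscale; ring.
rewrite (_ : vscale 1 (iter m T w) = iter m T w); last first.
  by apply: funext => n; rewrite /vscale mul1r.
have [Twl2 _] := iter_infprod_l2 m wl2; have [Tzl2 _] := iter_infprod_l2 m zl2.
apply: le_trans (l2norm_vadd Twl2 Tzl2) _.
have h1 : M * l2norm z <= M * (l2norm x + l2norm w) by rewrite ler_wpM2l.
have h2 : (M + M ^+ m) * l2norm w <= eps by rewrite mulrC -ler_pdivlMr // ltW.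
rewrite -/M in Tw.
by lra.
Qed.

End Iterates.

(** * Distinct digit sequences give distinct eigenvalues *)

Section EigenvalueInjectivity.
Variables (R : realType) (c : nat -> R[i]).
Hypothesis c_unit : forall i, cabs (c i) = 1.
Implicit Types e f : nat -> bool.

Lemma eigvalS e N : eigval c e N.+1 = eigval c e N * (if e N then c N else 1).
Proof. by rewrite /eigval big_ord_recr. Qed.

Lemma cabs_eigval e N : cabs (eigval c e N) = 1.
Proof.
elim: N => [|N IH]; first by rewrite /eigval big_ord0 cabs1.
by rewrite eigvalS cabsM IH mul1r; case: (e N); rewrite ?c_unit ?cabs1.
Qed.

Lemma cabs_limeigval e : ccvg (eigval c e) (limeigval c e) ->
  cabs (limeigval c e) = 1.
Proof.
move=> /ccvg_cabs2 h.
have h1 : cabs (eigval c e N) ^+ 2 @[N --> \oo] --> (1 : R).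
  by under eq_fun do rewrite cabs_eigval expr1n; apply: cvg_cst.
have /eqP : cabs (limeigval c e) ^+ 2 = 1 by apply: cvg_unique h h1.
by rewrite sqrp_eq1 ?cabs_ge0 // => /eqP.
Qed.

Hypothesis c_lacunary : forall i, cabs (c i.+1 - 1) <= cabs (c i - 1) / 4.

(** The factors after index [m] move the product by at most the sum of d 4^-k for 1 <= k <= j, where
    d = |c_m - 1|; the right side is its closed form. *)
Lemma eigval_tail e m j : cabs (eigval c e (m.+1 + j) - eigval c e m.+1) <=
  cabs (c m - 1) / 3 * (1 - 4^-1 ^+ j).
Proof.
set d := cabs (c m - 1).
have cd k : cabs (c (m + k)%N - 1) <= d * 4^-1 ^+ k.
  elim: k => [|k IH]; first by rewrite addn0 mulr1.
  rewrite addnS; apply: le_trans (c_lacunary _) _.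
  by rewrite exprSr mulrA ler_wpM2r ?invr_ge0.
elim: j => [|j IH]; first by rewrite addn0 !subrr cabs0 mulr0.
rewrite addnS eigvalS.
set g := eigval c e (m.+1 + j) in IH *; set r := if _ then _ else _.
have -> : g * r - eigval c e m.+1 = g * (r - 1) + (g - eigval c e m.+1) by ring.
apply: le_trans (cabsD _ _) _.
have hr : cabs (g * (r - 1)) <= d * 4^-1 ^+ j.+1.
  rewrite cabsM /g cabs_eigval mul1r /r addSnnS; case: (e _); first exact: cd.
  by rewrite subrr cabs0 mulr_ge0 ?cabs_ge0 ?exprn_ge0 ?invr_ge0.
apply: le_trans (lerD hr IH) _; rewrite exprS; set q := 4^-1 ^+ j.
by lra.
Qed.

Hypothesis c_neq1 : forall i, c i <> 1.

(** At the first differing digit the partial products are at distance d = |c_m - 1|, and each limit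
    is within d / 3 of its partial product. *)
Lemma limeigval_neq e f m : ccvg (eigval c e) (limeigval c e) ->
  ccvg (eigval c f) (limeigval c f) ->
  (forall i, (i < m)%N -> e i = f i) -> e m <> f m ->
  limeigval c e <> limeigval c f.
Proof.
move=> ce cf ef efm eq_lim.
set d := cabs (c m - 1).
have d0 : 0 < d.
  rewrite lt_neqAle cabs_ge0 andbT eq_sym; apply/eqP => /cabs_eq0/eqP.
  by rewrite subr_eq0 => /eqP; apply: c_neq1.
have close g : ccvg (eigval c g) (limeigval c g) ->
    cabs (limeigval c g - eigval c g m.+1) <= d / 3.
  move=> cg; apply: (ccvg_cabs_le (ccvgD cg (ccvg_cst _))).
  exists m.+1 => // N /= mN; rewrite -(subnKC mN).
  apply: le_trans (eigval_tail g m _) _.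
  by rewrite ler_piMr ?divr_ge0 ?(ltW d0) // gerBl exprn_ge0 ?invr_ge0.
have he := close _ ce; have hf := close _ cf; rewrite -eq_lim in hf.
have eqm : eigval c e m = eigval c f m.
  by apply: eq_bigr => i _; rewrite ef.
have dist : cabs (eigval c e m.+1 - eigval c f m.+1) = d.
  rewrite !eigvalS -eqm -mulrBr cabsM cabs_eigval mul1r /d.
  by move: efm; case: (e m); case: (f m) => // _; rewrite cabsBC.
have := cabsD (eigval c e m.+1 - limeigval c e) (limeigval c e - eigval c f m.+1).
rewrite addrA subrK dist [X in X + _]cabsBC.
by lra.
Qed.

End EigenvalueInjectivity.

(** * Binary expansions of points of [0, 1] and dyadic intervals *)

Section BinaryDigits.
Variable R : realType.
Implicit Types (t : R) (e : nat -> bool).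

(* Greedy binary expansion: [dyad t m] is the truncation of [t] to [m] digits. *)
Fixpoint dyad t m : R :=
  if m is k.+1 then
    dyad t k + (if dyad t k + 2^-1 ^+ k.+1 <= t then 2^-1 ^+ k.+1 else 0)
  else 0.

Definition digit t m : bool := dyad t m + 2^-1 ^+ m.+1 <= t.

Definition cylinder_start e m : R := \sum_(i < m) (if e i then 2^-1 ^+ i.+1 else 0).

(** The upper bound is attained at t = 1, all of whose greedy digits are 1. *)
Lemma dyad_bounds t m : 0 <= t <= 1 -> dyad t m <= t <= dyad t m + 2^-1 ^+ m.
Proof.
move=> t01; elim: m => [|m IH] /=; first by rewrite add0r expr0.
rewrite exprS; set q := 2^-1 ^+ m in IH *.
by case: ifPn => [h|]; [|rewrite -ltNge => h]; lra.
Qed.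

Lemma digit_inj t s : 0 <= t <= 1 -> 0 <= s <= 1 -> digit t =1 digit s -> t = s.
Proof.
move=> t01 s01 ts.
have eqd m : dyad t m = dyad s m.
  elim: m => [//|m IH] /=; have := ts m; rewrite /digit IH => ->.
  by [].
have h m : `|t - s| <= 2^-1 ^+ m.
  have := dyad_bounds m t01; have := dyad_bounds m s01; rewrite eqd.
  by rewrite ler_norml; lra.
apply/eqP; rewrite -subr_eq0 -normr_le0.
have hc : (2^-1 ^+ N : R) @[N --> \oo] --> (0 : R).
  by apply: cvg_expr; rewrite ger0_norm ?invr_ge0 // invf_lt1 ?ltr1n.
apply: (closed_cvg _ (@closed_ge R `|t - s|) _ _ hc).
by apply: nearW => N /=.
Qed.

(** A greedy digit is 1 exactly when the midpoint is reached, so each new digit selects one half of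
    the half-open dyadic interval. *)
Lemma cylinder_digit e m t :
  cylinder_start e m <= t < cylinder_start e m + 2^-1 ^+ m ->
  dyad t m = cylinder_start e m /\ forall i, (i < m)%N -> e i = digit t i.
Proof.
rewrite /cylinder_start; elim: m => [|m IH]; first by rewrite big_ord0.
rewrite big_ord_recr /= exprS; set a := \sum_(i < m) _ in IH *.
set q := 2^-1 ^+ m in IH *; move=> h.
have q0 : 0 <= q by rewrite exprn_ge0 ?invr_ge0.
have [|da dig] := IH; first by move: h; case: (e m); lra.
have dm : digit t m = e m.
  rewrite /digit da exprS -/q; move: h; case: (e m) => h; first by lra.
  by apply/negbTE; rewrite -ltNge; lra.
split; first by rewrite -dm da /digit exprS da.
by move=> i; rewrite ltnS leq_eqVlt => /orP[/eqP->|/dig].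
Qed.

Lemma cylinder_start_bounds e m :
  0 <= cylinder_start e m /\ cylinder_start e m + 2^-1 ^+ m <= 1.
Proof.
rewrite /cylinder_start; elim: m => [|m IH]; first by rewrite big_ord0 expr0 add0r.
rewrite big_ord_recr /= exprS; set a := \sum_(i < m) _ in IH *.
set q := 2^-1 ^+ m in IH *.
have q0 : 0 <= q by rewrite exprn_ge0 ?invr_ge0.
by case: (e m); lra.
Qed.

Lemma measurable_dyad m : measurable_fun setT (dyad ^~ m : R -> R).
Proof.
elim: m => [|m IH] /=; first exact: measurable_cst.
apply: measurable_funD => //; apply: measurable_fun_ifT => //.
by apply: measurable_fun_ler => //; apply: measurable_funD.
Qed.

Lemma measurable_digit m : measurable_fun setT (digit ^~ m : R -> bool).
Proof.
apply: measurable_fun_ler => //; apply: measurable_funD => //.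
exact: measurable_dyad.
Qed.

End BinaryDigits.

(** * The law of the eigenvalue under random digits *)

Section SpectralMeasure.
Variables (R : realType) (c : nat -> R[i]).
Hypothesis c_cvg : forall e, ccvg (eigval c e) (limeigval c e).

Definition circle_map (t : R) : R * R :=
  (complex.Re (limeigval c (digit t)), complex.Im (limeigval c (digit t))).

Lemma to_complex_circle_map t : to_complex (circle_map t) = limeigval c (digit t).
Proof. by rewrite /circle_map; case: limeigval. Qed.

Lemma measurable_eigval N :
  measurable_fun setT (fun t : R => complex.Re (eigval c (digit t) N)) /\
  measurable_fun setT (fun t : R => complex.Im (eigval c (digit t) N)).
Proof.
elim: N => [|N [IHr IHi]].
  rewrite /eigval; split.
    by under eq_fun do rewrite big_ord0; apply: measurable_cst.
  by under eq_fun do rewrite big_ord0; apply: measurable_cst.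
have mr : measurable_fun setT (fun t : R => if digit t N then complex.Re (c N) else 1).
  by apply: measurable_fun_ifT => //; apply: measurable_digit.
have mi : measurable_fun setT (fun t : R => if digit t N then complex.Im (c N) else 0).
  by apply: measurable_fun_ifT => //; apply: measurable_digit.
split.
  rewrite (_ : (fun t : R => _) = (fun t =>
    complex.Re (eigval c (digit t) N) * (if digit t N then complex.Re (c N) else 1) -
    complex.Im (eigval c (digit t) N) * (if digit t N then complex.Im (c N) else 0))).
    by apply: measurable_funB; apply: measurable_funM.
  by apply: funext => t; rewrite eigvalS ReM; case: (digit t N).
rewrite (_ : (fun t : R => _) = (fun t =>
  complex.Re (eigval c (digit t) N) * (if digit t N then complex.Im (c N) else 0) +
  complex.Im (eigval c (digit t) N) * (if digit t N then complex.Re (c N) else 1))).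
  by apply: measurable_funD; apply: measurable_funM.
by apply: funext => t; rewrite eigvalS ImM; case: (digit t N).
Qed.

Lemma measurable_circle_map : measurable_fun setT circle_map.
Proof.
apply: measurable_fun_pair.
  apply: (measurable_fun_cvg (fun N => proj1 (measurable_eigval N))) => t _.
  by have [] := c_cvg (digit t).
apply: (measurable_fun_cvg (fun N => proj2 (measurable_eigval N))) => t _.
by have [] := c_cvg (digit t).
Qed.

Definition unif01 : probability _ R := uniform_prob (@ltr01 R).

Definition circle_rv : {mfun measurableTypeR R >-> (R * R)%type} :=
  @mfun_Sub _ _ (measurableTypeR R) (R * R)%type _ (mem_set measurable_circle_map).

Definition circle_measure : probability (R * R)%type R :=
  distribution unif01 circle_rv.

Lemma unif01_itv (a b : R) : 0 <= a -> a < b -> b <= 1 ->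
  unif01 `[a, b[%classic = (b - a)%:E.
Proof.
move=> a0 ab b1; rewrite /unif01 /= /uniform_prob.
rewrite (eq_integral (fun=> 1%E)); last first.
  move=> x; rewrite inE /= in_itv /= => /andP[ax xb].
  rewrite /uniform_pdf subr0 invr1 (le_trans a0 ax) /=.
  by rewrite (ltW (lt_le_trans xb b1)).
by rewrite integral_cst //= mul1e lebesgue_measure_itv /= lte_fin ab.
Qed.

(** The uniform density vanishes off [0, 1], and [A] has at most one point there. *)
Lemma unif01_null (A : set R) s : measurable A ->
  (forall t, A t -> 0 <= t <= 1 -> t = s) -> unif01 A = 0%E.
Proof.
move=> mA As; rewrite /unif01 /= /uniform_prob integral_uniform_pdf.
have A0 : lebesgue_measure (A `&` `[0, 1]%classic) = 0%E.
  apply: countable_lebesgue_measure0; apply: sub_countable (countable1 s).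
  by apply: subset_card_le => t [At /=]; rewrite in_itv /=; apply: As.
apply: null_set_integral => //; first exact: measurableI.
by apply/measurable_EFinP/measurable_funTS; exact: measurable_uniform_pdf.
Qed.

Lemma circle_measure_atomless p :
  (forall t s, 0 <= t <= 1 -> 0 <= s <= 1 -> circle_map t = circle_map s -> t = s) ->
  circle_measure [set p] = 0%E.
Proof.
move=> inj.
have mA : measurable (circle_map @^-1` [set p]).
  rewrite -[X in measurable X]setTI; apply: measurable_circle_map => //.
  rewrite (_ : [set p] = [set p.1] `*` [set p.2]); first exact: measurableX.
  by apply/seteqP; case: p => a b; split=> -[u v] /= [-> ->].
change (unif01 (circle_map @^-1` [set p]) = 0%E).
have [[s [s01 sp]]|h] := pselect (exists s, 0 <= s <= 1 /\ circle_map s = p).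
  by apply: (@unif01_null _ s mA) => t /= tp t01; apply: inj; rewrite ?tp.
(* The fibre misses [0, 1], so the point 0 is an arbitrary choice. *)
by apply: (@unif01_null _ 0 mA) => t /= tp t01; case: h; exists t.
Qed.

(** The dyadic interval with prefix [e] has mass 2^-m > 0 and cannot lie in the null complement of
    the preimage of [B]. *)
Lemma circle_measure_full_dense (B : set (R * R)) e m : measurable B ->
  circle_measure B = 1%E ->
  exists2 t, B (circle_map t) & forall i, (i < m)%N -> e i = digit t i.
Proof.
move=> mB B1.
have mA : measurable (circle_map @^-1` B).
  by rewrite -[X in measurable X]setTI; apply: measurable_circle_map.
have A1 : unif01 (circle_map @^-1` B) = 1%E by exact: B1.
have [a0 a1] := @cylinder_start_bounds R e m.
set a := cylinder_start R e m in a0 a1.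
have q0 : 0 < 2^-1 ^+ m :> R by rewrite exprn_gt0 ?invr_gt0.
apply: contrapT => hn.
have sub : `[a, a + 2^-1 ^+ m[%classic `<=` ~` (circle_map @^-1` B).
  move=> t /=; rewrite in_itv /= => /cylinder_digit[_ dig] Bt.
  by apply: hn; exists t.
have AC : unif01 (~` (circle_map @^-1` B)) = 0%E.
  by rewrite probability_setC // A1 subee.
have : (unif01 `[a, (a + 2^-1 ^+ m)%R[%classic <=
        unif01 (~` (circle_map @^-1` B)))%E.
  by apply: le_measure => //; apply: mem_set; [exact: measurable_itv|exact: measurableC].
rewrite AC unif01_itv ?ltrDl //.
by rewrite addrAC subrr add0r lee_fin leNgt q0.
Qed.

End SpectralMeasure.

(** * Choice of the multipliers mu_i *)

Lemma lacunary_choice (R : realType) (n : nat -> nat) (eta : nat -> R) :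
  n 0%N = 1%N -> (forall i, 0 < eta i) ->
  (forall eps : R, 0 < eps ->
     exists l : R[i], cabs l = 1 /\ l <> 1 /\
       forall k, cabs (l ^+ n k - 1) <= eps) ->
  exists mu : nat -> R[i], [/\ forall i, cabs (mu i) = 1, forall i, mu i <> 1,
    forall i k, cabs (mu i ^+ n k - 1) <= eta i
    & forall i, cabs (mu i.+1 - 1) <= cabs (mu i - 1) / 4].
Proof.
move=> n0 eta0 H.
have /choice[f fP] : forall eps : R, exists l : R[i], 0 < eps ->
    cabs l = 1 /\ l <> 1 /\ forall k, cabs (l ^+ n k - 1) <= eps.
  move=> eps; have [e0|e0] := ltP 0 eps; last by exists 0.
  by have [l hl] := H _ e0; exists l.
(* The choice is recursive because the lacunarity bound on each term depends on the previous one. *)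
pose mu := fix mu i := if i is j.+1
  then f (Num.min (eta i) (cabs (mu j - 1) / 4)) else f (eta i).
have d0 (z : R[i]) : z <> 1 -> 0 < cabs (z - 1) / 4.
  move=> z1; rewrite divr_gt0 // lt_neqAle cabs_ge0 andbT eq_sym.
  by apply/eqP => /cabs_eq0/eqP; rewrite subr_eq0 => /eqP.
have hmu i : mu i <> 1.
  by elim: i => [|i IH] /=; apply: (fP _ _).2.1; rewrite // lt_min eta0 d0.
have hmin i : 0 < Num.min (eta i.+1) (cabs (mu i - 1) / 4).
  by rewrite lt_min eta0 d0.
exists mu; split=> //.
- by case=> [|i] /=; apply: (fP _ _).1.
- case=> [|i] k /=; first exact: (fP _ _).2.2.
  by apply: le_trans ((fP _ (hmin i)).2.2 k) _; rewrite ge_min lexx.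
(* Since n_0 = 1, the estimate at k = 0 concerns mu_(i+1) - 1 itself. *)
- move=> i /=; have := (fP _ (hmin i)).2.2 0%N; rewrite n0 expr1 => h.
  by apply: le_trans h _; rewrite ge_min lexx orbT.
Qed.

(** * The operator for a given delta: boundedness, spanning, powers and point spectrum *)

Theorem theorem2p1 (R : realType) (n : nat -> nat) :
  n 0%N = 1%N ->
  (forall k, (n k < n k.+1)%N) ->
  (forall eps : R, 0 < eps ->
     exists l : R[i], cabs l = 1 /\ l <> 1 /\
       forall k, cabs (l ^+ n k - 1) <= eps) ->
  forall delta : R, 0 < delta ->
    exists T : cseq R -> cseq R,
      [/\ bounded_operator T,
          perfectly_spanning T,
          (forall k, opnorm_le (iter (n k) T) (1 + delta))
        & ~ countable (unimodular_point_spectrum T)].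
Proof.
move=> n0 _ H delta delta_gt0.
(* The threshold of [small] divided by the bound on P_i: the powers mu_i^(n_k) are then small for
   every k, and n_0 = 1 covers the mu_i themselves. *)
pose eta i : R := delta * 2^-1 ^+ i.+1 / (1 + delta) / bitproj_bound R i.
have eta0 i : 0 < eta i.
  by rewrite !divr_gt0 ?bitproj_bound_gt0 ?addr_gt0 // mulr_gt0 // exprn_gt0 // invr_gt0.
have [mu [mu_unit mu1 mu_eta mu_lac]] := lacunary_choice n0 eta0 H.
have scn k : small delta (fun i => mu i ^+ n k).
  by move=> i; rewrite -ler_pdivlMr ?bitproj_bound_gt0.
have sc : small delta mu by move=> i; have := scn 0%N i; rewrite n0 expr1.
have cv e : ccvg (eigval mu e) (limeigval mu e) := eigval_cvg delta_gt0 e sc.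
have lam1 e := cabs_limeigval mu_unit (cv e).
have inj (t s : R) : 0 <= t <= 1 -> 0 <= s <= 1 ->
    limeigval mu (digit t) = limeigval mu (digit s) -> t = s.
  move=> t01 s01 lts; apply: contrapT => ts.
  (* The least such index is the first difference that [limeigval_neq] requires. *)
  have ex : exists m, digit t m != digit s m.
    apply: contrapT => h; apply: ts; apply: digit_inj => // m.
    by apply/eqP; apply: contrapT => hm; apply: h; exists m; apply/negP.
  apply: (limeigval_neq mu_unit mu_lac mu1 (cv _) (cv _) _ _ lts (m := ex_minn ex)).
    case: ex_minnP => m _ hm i im; apply/eqP; apply: contraTT im => /hm.
    by rewrite leqNgt.
  by case: ex_minnP => m /eqP.
have eig e : Defs.eigenspace (infprod mu) (limeigval mu e) (evec R e).
  by split; [exact: evec_l2 | exact: (infprod_evec delta_gt0 e sc)].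
exists (infprod mu); split.
- split=> [x xl2|a x y xl2 yl2|].
  + by have [] := infprod_l2 delta_gt0 sc xl2.
  + exact: (infprod_linear delta_gt0 a sc xl2 yl2).
  + by exists (1 + delta) => x xl2; have [] := infprod_l2 delta_gt0 sc xl2.
- exists (circle_measure cv); split.
  + change (unif01 R (circle_map mu @^-1` @unit_circle R) = 1%E).
    rewrite (_ : _ @^-1` _ = setT) ?probability_setT //.
    apply/seteqP; split=> // t _ /=.
    by have := sqr_cabs (limeigval mu (digit t)); rewrite lam1 expr1n => /esym.
  + move=> p; apply: circle_measure_atomless => t s t01 s01.
    by move=> /(congr1 (@to_complex R)); rewrite !to_complex_circle_map; apply: inj.
  + move=> B mB Bc B1; apply: dense_span_of_cspan; apply: cspan_of_evec_dense.
      by move=> x [p _ []].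
    move=> e m; have [t Bt dig] := circle_measure_full_dense e m mB B1.
    exists (digit t) => //; exists (circle_map mu t) => //.
    by rewrite to_complex_circle_map; apply: eig.
- by move=> k; apply: iter_infprod_opnorm.
(* The eigenvalue map embeds [0, 1] into the point spectrum; countability would make [0, 1] a
   Lebesgue null set. *)
- move=> /countable_injP[g ginj].
  have : countable (`[0%R, 1%R]%classic : set R).
    apply/countable_injP; exists (fun t => g (limeigval mu (digit t))) => t s.
    rewrite !inE /= !in_itv /= => t01 s01 gts; apply: inj => //.
    have mem t' : limeigval mu (digit t') \in unimodular_point_spectrum (infprod mu).
      apply: mem_set; split; first exact: lam1.
      exists (evec R (digit t')); split; first exact: eig.
      move=> /(congr1 (fun x : cseq R => x 0%N)) /eqP.
      by rewrite evec0 oner_eq0.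
    exact: ginj gts.
  move=> /countable_lebesgue_measure0; rewrite lebesgue_measure_itv /= lte_fin ltr01.
  by rewrite oppr0 adde0 => /eqP; rewrite onee_eq0.
Qed.
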